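(* For $i=1,\dots,k$ let $\Omega_i\subseteq\mathbb{C}^{n_i}$ be a bounded, convex, balanced domain and let $D_i\subseteq\mathbb{C}^{n_i}$ be a bounded domain. Put $\Omega=\Omega_1\times\cdots\times\Omega_k$ and $D=D_1\times\cdots\times D_k$ in $\mathbb{C}^{n}$, $n=n_1+\cdots+n_k$. If each $D_i$ is holomorphic homogeneous regular with respect to $\Omega_i$, then $D$ is holomorphic homogeneous regular with respect to $\Omega$.
   Context: A domain $\Omega\subseteq\mathbb{C}^m$ is balanced if $\lambda z\in\Omega$ for each $z\in\Omega$ and each $\lambda\in\mathbb{C}$ with $|\lambda|\leq 1$. Its Minkowski function is $h_\Omega(z):=\inf\{t>0:z/t\in\Omega\}$, and for $0<r\leq 1$, $\Omega(r):=\{z\in\mathbb{C}^m:h_\Omega(z)<r\}$. $\mathcal{O}_u(D,\Omega)$ denotes the set of injective holomorphic maps $D\to\Omega$. For a bounded domain $D\subseteq\mathbb{C}^m$ and a bounded, balanced, convex domain $\Omega\subseteq\mathbb{C}^m$, the generalized squeezing function is $$S_D^{\Omega}(z):=\sup\{r\in(0,1]:\Omega(r)\subseteq f(D),\ f\in\mathcal{O}_u(D,\Omega),\ f(z)=0\},\quad z\in D.$$ $D$ is called holomorphic homogeneous regular (with respect to $\Omega$) if $S_D^{\Omega}$ has a positive lower bound on $D$. *)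

(* Defs.v *)
From HB Require Import structures.
From mathcomp Require Import all_boot all_order all_algebra.
From mathcomp Require Import complex.
From mathcomp Require Import all_classical all_reals all_analysis.

Set Implicit Arguments.
Unset Strict Implicit.
Unset Printing Implicit Defensive.

Import Order.TTheory GRing.Theory Num.Theory.
Import numFieldNormedType.Exports.

Local Open Scope classical_set_scope.
Local Open Scope ring_scope.
Local Open Scope complex_scope.

(* R[i], packed as a numClosedFieldType: the norm and topology are inherited
   from that structure, so 'rV[Cplx R]_m is a normedModType over Cplx R (with
   the sup norm), and [differentiable] on it is complex (Frechet)
   differentiability. *)
Definition Cplx (R : realType) : numClosedFieldType := R[i].

Section SqueezingFunction.
Variables (R : realType) (m : nat).
Local Notation Cm := 'rV[Cplx R]_m.

Definition domain (D : set Cm) : Prop :=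
  [/\ D !=set0, open D & connected D].

Definition balanced (Omega : set Cm) : Prop :=
  forall (z : Cm) (l : Cplx R), Omega z -> `|l| <= 1 -> Omega (l *: z).

(* [inf] is the infimum in R; for a domain Omega containing 0 the set is
   nonempty and bounded below by 0. *)
Definition minkowski_fun (Omega : set Cm) (z : Cm) : R :=
  inf [set t : R | 0 < t /\ Omega ((t%:C : Cplx R)^-1 *: z)].

Definition minkowski_ball (Omega : set Cm) (r : R) : set Cm :=
  [set z | minkowski_fun Omega z < r].

(* Maps D -> Omega are represented by total maps restricted to D, and D is
   meant to be open, so values outside D are irrelevant. *)
Definition injective_holomorphic (D Omega : set Cm) (f : Cm -> Cm) : Prop :=
  [/\ forall z, D z -> differentiable f z,
      {in D &, injective f} & f @` D `<=` Omega].

(* The set is bounded above by 1; it is nonempty when D is bounded, z is in D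
   and Omega is a neighborhood of 0. *)
Definition squeezing (D Omega : set Cm) (z : Cm) : R :=
  sup [set r : R | [/\ 0 < r, r <= 1 &
    exists f : Cm -> Cm, [/\ injective_holomorphic D Omega f, f z = 0 &
      minkowski_ball Omega r `<=` f @` D]]].

Definition holomorphic_homogeneous_regular (D Omega : set Cm) : Prop :=
  exists2 c : R, 0 < c & forall z, D z -> c <= squeezing D Omega z.

End SqueezingFunction.

(* C^(n_1 + ... + n_k) is identified with the product of the C^(n_i) by
   cutting row vectors into consecutive blocks. *)
Definition prod_set (R : realType) (k : nat) (n : 'I_k -> nat)
    (A : forall i : 'I_k, set 'rV[Cplx R]_(n i)) :
    set 'rV[Cplx R]_(\sum_(i < k) n i) :=
  [set z | forall i : 'I_k, A i (submxrow z i)].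

(* Main.v *)
Require Import Defs.
From HB Require Import structures.
From mathcomp Require Import all_boot all_order all_algebra.
From mathcomp Require Import complex.
From mathcomp Require Import all_classical all_reals all_analysis.

Set Implicit Arguments.
Unset Strict Implicit.
Unset Printing Implicit Defensive.

Import Order.TTheory GRing.Theory Num.Theory.
Import numFieldNormedType.Exports.
Local Open Scope classical_set_scope.
Local Open Scope ring_scope.

(* Squeeze each factor separately and take the product of the maps f_i. Since
   h_Omega(w) < r forces h_(Omega_i)(w_i) < r for all i, the image of the
   product map contains Omega(r) as soon as each f_i(D_i) contains
   Omega_i(r), and a single r below the finitely many lower bounds works. *)

(** Expanding rows in the basis [delta_mx 0 j] turns [g] into a finite sum of scalar functions times
    constant vectors. *)
Lemma differentiable_row (K : numFieldType) (V : normedModType K) (n : nat)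
    (g : V -> 'rV[K]_n) (x : V) :
  (forall j, differentiable (fun w => g w 0 j : K) x) -> differentiable g x.
Proof.
move=> dg.
have -> : g = \sum_(j < n) (fun w => g w 0 j *: (delta_mx 0 j : 'rV[K]_n)).
  by apply/funext => w; rewrite fct_sumE [LHS]row_sum_delta.
apply: differentiable_sum => j.
exact: differentiableZl.
Qed.

Lemma differentiable_submxrow (K : numFieldType) (k : nat) (n : 'I_k -> nat)
    (i : 'I_k) (x : 'rV[K]_(\sum_(i < k) n i)) :
  differentiable (fun w : 'rV[K]_(\sum_(i < k) n i) => submxrow w i) x.
Proof.
apply: differentiable_row => j.
have -> : (fun w : 'rV[K]_(\sum_(i < k) n i) => submxrow w i 0 j) =
    (fun w => w 0 (tagnat.Rank i j)).
  by apply/funext => w; rewrite mxE.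
exact: differentiable_coord.
Qed.

Lemma differentiable_mxrow (K : numFieldType) (V : normedModType K) (k : nat)
    (n : 'I_k -> nat) (g : forall i, V -> 'rV[K]_(n i)) (x : V) :
  (forall i, differentiable (g i) x) ->
  differentiable (fun w => \mxrow_i g i w) x.
Proof.
move=> dg; apply: differentiable_row => s.
have -> : (fun w : V => (\mxrow_i g i w) 0 s) =
    (fun w => g (tagnat.sig1 s) w 0 (tagnat.sig2 s)).
  by apply/funext => w; rewrite mxE.
exact: (differentiable_comp (dg _) (differentiable_coord _ _ _)).
Qed.

Lemma injective_holomorphic_prod (R : realType) (k : nat) (n : 'I_k -> nat)
    (D Omega : forall i : 'I_k, set 'rV[Cplx R]_(n i))
    (f : forall i, 'rV[Cplx R]_(n i) -> 'rV[Cplx R]_(n i)) :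
  (forall i, injective_holomorphic (D i) (Omega i) (f i)) ->
  injective_holomorphic (prod_set D) (prod_set Omega)
    (fun w => \mxrow_i f i (submxrow w i)).
Proof.
move=> hf; split=> [w Dw|w w' /set_mem Dw /set_mem Dw' eq_f|_ [w Dw <-] i].
- apply: differentiable_mxrow => i.
  have [df _ _] := hf i.
  by apply: differentiable_comp; [exact: differentiable_submxrow | exact/df/Dw].
- apply/mxrowP => i; have [_ injf _] := hf i.
  by apply: injf; [exact/mem_set/Dw | exact/mem_set/Dw' |
    move: i; exact/eq_mxrowP].
- rewrite mxrowK; have [_ _] := hf i; apply.
  by exists (submxrow w i) => //; exact: Dw.
Qed.

Lemma balanced0 (R : realType) (m : nat) (Omega : set 'rV[Cplx R]_m) :
  Omega !=set0 -> balanced Omega -> Omega 0.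
Proof.
by move=> [z Oz] bal; rewrite -(scale0r z); apply: bal; rewrite ?normr0.
Qed.

(* Rules out the junk value inf set0 = 0 of the Minkowski function. *)
Lemma prod_absorbing (R : realType) (k : nat) (n : 'I_k -> nat)
    (Omega : forall i : 'I_k, set 'rV[Cplx R]_(n i))
    (w : 'rV[Cplx R]_(\sum_(i < k) n i)) :
  (forall i, nbhs (0 : 'rV[Cplx R]_(n i)) (Omega i)) ->
  exists2 t : R, 0 < t & prod_set Omega ((t%:C%C : Cplx R)^-1 *: w).
Proof.
move=> O0.
(* Each block [s *: submxrow w i] tends to 0 with [s]; there are finitely many blocks, so one
   neighborhood of 0 serves all of them. *)
have : \forall s \near (0 : Cplx R), forall i, Omega i (s *: submxrow w i).
  apply: (filter_forall (nbhs_filter (0 : Cplx R))) => i.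
  have := @scalel_continuous _ _ (submxrow w i) (0 : Cplx R).
  by apply; rewrite scale0r; exact: O0.
case/nbhs_ballP => e /= e0 /(_ (e / 2)) sub.
have e2 : 0 < e / 2 by rewrite divr_gt0.
(* The radius [e] lives in [Cplx R], but the order there makes a positive element real. The scalar
   [e / 2] is thus some real [a], and [t] is its inverse. *)
have [a a0 ea] : exists2 a : R, 0 < a & e / 2 = (a%:C%C : Cplx R).
  move: e2; case: (e / 2) => a b; rewrite ltcE /= => /andP[/eqP b0 a0].
  by exists a => //; move: b0 => /= ->.
exists a^-1; first by rewrite invr_gt0.
have -> : ((a^-1)%:C%C : Cplx R)^-1 = e / 2 by rewrite fmorphV invrK ea.
move=> i.
suff -> : submxrow ((e / 2) *: w) i = (e / 2) *: submxrow w i.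
  apply: sub; rewrite /ball /= sub0r normrN gtr0_norm //.
  by rewrite ltr_pdivrMr // mulr_natr mulr2n ltrDl.
by apply/rowP => j; rewrite !mxE.
Qed.

(** A scale [s < r] that brings [w] into the product brings every block into its factor, so each
    factor's infimum is at most [s]. *)
Lemma minkowski_ball_prod (R : realType) (k : nat) (n : 'I_k -> nat)
    (Omega : forall i : 'I_k, set 'rV[Cplx R]_(n i)) (r : R) :
  (forall i, nbhs (0 : 'rV[Cplx R]_(n i)) (Omega i)) ->
  minkowski_ball (prod_set Omega) r `<=`
    prod_set (fun i => minkowski_ball (Omega i) r).
Proof.
move=> O0 w wr i; have [t t0 Ot] := prod_absorbing w O0.
(* Absorption makes the set of scales nonempty, so its infimum being below [r] yields an actual
   scale. *)
have [|s [s0 Os] sr] := inf_lt _ wr; first by exists t.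
apply: le_lt_trans sr; apply: ge_inf; first by exists 0 => t1 [/ltW].
split=> //; move: (Os i).
by congr (Omega i _); apply/rowP => j; rewrite !mxE.
Qed.

Lemma minkowski_ball_le (R : realType) (m : nat) (Omega : set 'rV[Cplx R]_m)
    (r s : R) :
  r <= s -> minkowski_ball Omega r `<=` minkowski_ball Omega s.
Proof. by move=> rs w /lt_le_trans; apply. Qed.

(** The supremum need not be attained, hence the strict inequality: some admissible radius exceeds
    [c], and its map also covers the smaller ball. *)
Lemma squeezing_gt (R : realType) (m : nat) (D Omega : set 'rV[Cplx R]_m)
    (z : 'rV[Cplx R]_m) (c : R) :
  0 <= c -> c < squeezing D Omega z ->
  exists f, [/\ injective_holomorphic D Omega f, f z = 0 &
                minkowski_ball Omega c `<=` f @` D].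
Proof.
move=> c0 cS.
have [|r [_ _ [f [hf fz sub]]] cr] := sup_gt _ cS.
  (* An empty set of radii would give the default [sup set0 = 0], against
     [0 <= c < squeezing D Omega z]. *)
  apply/set0P/negP => /eqP E.
  by move: (le_lt_trans c0 cS); rewrite /squeezing E sup0 ltxx.
by exists f; split=> //; apply: subset_trans sub; exact/minkowski_ball_le/ltW.
Qed.

Lemma squeezing_ge (R : realType) (m : nat) (D Omega : set 'rV[Cplx R]_m)
    (z : 'rV[Cplx R]_m) (c : R) f :
  0 < c -> c <= 1 -> injective_holomorphic D Omega f -> f z = 0 ->
  minkowski_ball Omega c `<=` f @` D -> c <= squeezing D Omega z.
Proof.
move=> c0 c1 hf fz sub; apply: ub_le_sup; first by exists 1 => r [].
by split=> //; exists f.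
Qed.

Lemma squeezing_prod_ge (R : realType) (k : nat) (n : 'I_k -> nat)
    (D Omega : forall i : 'I_k, set 'rV[Cplx R]_(n i))
    (z : 'rV[Cplx R]_(\sum_(i < k) n i)) (c : R) :
  (forall i, nbhs (0 : 'rV[Cplx R]_(n i)) (Omega i)) -> 0 < c -> c <= 1 ->
  (forall i, c < squeezing (D i) (Omega i) (submxrow z i)) ->
  c <= squeezing (prod_set D) (prod_set Omega) z.
Proof.
move=> O0 c0 c1 cS.
(* Choice fixes one squeezing map per factor, centred at the corresponding block of [z]. *)
pose F i := cid (squeezing_gt (ltW c0) (cS i)).
pose f i := sval (F i); have hf i := svalP (F i).
apply: (@squeezing_ge _ _ _ _ _ _ (fun w => \mxrow_i f i (submxrow w i))) => //.
- by apply: injective_holomorphic_prod => i; case: (hf i).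
- by rewrite -[RHS]mxrow0; apply: eq_mxrow => i; case: (hf i).
move=> w /(minkowski_ball_prod O0) wc.
(* Preimages are found block by block and then glued into a preimage under the product map. *)
have pre i : exists u, D i u /\ f i u = submxrow w i.
  have [_ _ sub] := hf i.
  by have [v Dv fv] := sub _ (wc i); exists v.
pose u i := sval (cid (pre i)); have hu i := svalP (cid (pre i)).
exists (\mxrow_i u i); first by move=> i; rewrite mxrowK; case: (hu i).
by apply/mxrowP => i; rewrite !mxrowK; case: (hu i).
Qed.

Theorem mainTheorem6 (R : realType) (k : nat) (n : 'I_k -> nat)
    (Omega D : forall i : 'I_k, set 'rV[Cplx R]_(n i))
    (Omega_domain : forall i, domain (Omega i))
    (Omega_bounded : forall i, bounded_set (Omega i))
    (Omega_convex : forall i, convex_set (Omega i))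
    (Omega_balanced : forall i, balanced (Omega i))
    (D_domain : forall i, domain (D i))
    (D_bounded : forall i, bounded_set (D i)) :
  (forall i, holomorphic_homogeneous_regular (D i) (Omega i)) ->
  holomorphic_homogeneous_regular (prod_set D) (prod_set Omega).
Proof.
move=> hD.
have O0 i : nbhs (0 : 'rV[Cplx R]_(n i)) (Omega i).
  have [neO opO _] := Omega_domain i.
  by apply: open_nbhs_nbhs; split=> //; exact: balanced0.
have : forall i, exists c : R, 0 < c /\
    forall z, D i z -> c <= squeezing (D i) (Omega i) z.
  by move=> i; have [c c0 hc] := hD i; exists c.
move=> /choice[c hc].
(* Strictness of [d < c i] leaves the room that [squeezing_gt] requires, and [d <= 1] keeps [d] an
   admissible radius. Taking [d] close to 0 from the right meets these finitely many conditions at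
   once, even for [k = 0]. *)
have [d [d0 d1 dc]] : exists d : R, [/\ 0 < d, d <= 1 & forall i, d < c i].
  have : \forall d \near 0^'+, forall i, (d : R) < c i.
    by apply: filter_forall => i; apply: nbhs_right_lt; case: (hc i).
  move=> dc; near (0 : R)^'+ => d; exists d; split.
  - by near: d; exact: nbhs_right_gt.
  - by near: d; exact: nbhs_right_le.
  - by near: d.
exists d => // z Dz; apply: squeezing_prod_ge => // i.
by apply: lt_le_trans (dc i) _; apply: (hc i).2; exact: Dz.
Unshelve. all: by end_near. Qed.
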